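(* Let $0<s<1$ and suppose that either $n\ge 2$, or $n=1$ and $0<s<1/2$. For every $y>0$ the function $$E_{s,y}(x)=\alpha(n,s)\,(y^2+|x|^2)^{-\frac{n-2s}{2}},\qquad \alpha(n,s)=\frac{\Gamma\left(\frac n2-s\right)}{2^{2s}\,\pi^{\frac n2}\,\Gamma(s)},$$ satisfies, for every $x\in\mathbb R^n$, $$(-\Delta)^s E_{s,y}(x)=y^{2s}\,\frac{\Gamma\left(\frac n2+s\right)}{\pi^{\frac n2}\,\Gamma(s)}\,\left(y^2+|x|^2\right)^{-\left(\frac n2+s\right)} .$$
   Context: For $v\in C^2(\mathbb R^n)\cap L^\infty(\mathbb R^n)$, $$(-\Delta)^s v(x)=\frac{\gamma(n,s)}{2}\int_{\mathbb R^n}\frac{2v(x)-v(x+z)-v(x-z)}{|z|^{n+2s}}\,dz,\qquad \gamma(n,s)=\frac{s\,2^{2s}\,\Gamma\left(\frac{n+2s}{2}\right)}{\pi^{n/2}\,\Gamma(1-s)}.$$ *)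

(* Defs.v *)
From HB Require Import structures.
From mathcomp Require Import all_boot all_order all_algebra.
From mathcomp Require Import all_classical all_reals all_analysis.

Set Implicit Arguments.
Unset Strict Implicit.
Unset Printing Implicit Defensive.

Import Order.TTheory GRing.Theory Num.Theory.
Import numFieldNormedType.Exports.

Local Open Scope classical_set_scope.
Local Open Scope ring_scope.

(* Lebesgue measure on R^n, carried by n.-tuple R with its product
   sigma-algebra: the image of lebesgue_measure \x (Lebesgue measure on R^n)
   under (a, t) |-> a :: t. *)

Section tuple_cons.
Context d (T : measurableType d) (n : nat).

Definition tuple_cons (p : T * n.-tuple T) : n.+1.-tuple T :=
  [tuple of p.1 :: p.2].

Definition tuple_uncons (t : n.+1.-tuple T) : T * n.-tuple T :=
  (thead t, [tuple of behead t]).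

Lemma tuple_consK : cancel tuple_cons tuple_uncons.
Proof. by move=> [a t]; congr pair; apply: val_inj. Qed.

Lemma measurable_tuple_cons : measurable_fun [set: T * n.-tuple T] tuple_cons.
Proof. exact: measurable_cons measurable_fst measurable_snd. Qed.

Lemma measurable_tuple_uncons : measurable_fun [set: n.+1.-tuple T] tuple_uncons.
Proof.
by apply: measurable_fun_pair; [exact: measurable_tnth|exact: measurable_behead].
Qed.

End tuple_cons.

Section lebesgue_tupleS.
Context (R : realType) (n : nat).
Variable mu : {sigma_finite_measure set (n.-tuple (measurableTypeR R)) -> \bar R}.

Definition lebesgue_tupleS : set (n.+1.-tuple (measurableTypeR R)) -> \bar R :=
  pushforward (@lebesgue_measure R \x mu)%E (@tuple_cons _ (measurableTypeR R) n).

Let mtuple_cons := @measurable_tuple_cons _ (measurableTypeR R) n.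

Let lebesgue_tupleS0 : lebesgue_tupleS set0 = 0%E.
Proof. by rewrite /lebesgue_tupleS /pushforward preimage_set0 measure0. Qed.

Let lebesgue_tupleS_ge0 A : (0 <= lebesgue_tupleS A)%E.
Proof. exact: measure_ge0. Qed.

Let lebesgue_tupleS_sigma_additive : semi_sigma_additive lebesgue_tupleS.
Proof.
move=> F mF tF mUF; rewrite /lebesgue_tupleS /pushforward preimage_bigcup.
apply: measure_semi_sigma_additive.
- by move=> i; rewrite -[X in measurable X]setTI; exact: mtuple_cons.
- apply/trivIsetP => /= i j _ _ ij; rewrite -preimage_setI.
  by move/trivIsetP : tF => /(_ _ _ _ _ ij) ->//; rewrite preimage_set0.
- by rewrite -preimage_bigcup -[X in measurable X]setTI; exact: mtuple_cons.
Qed.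

HB.instance Definition _ := isMeasure.Build _ _ _ lebesgue_tupleS
  lebesgue_tupleS0 lebesgue_tupleS_ge0 lebesgue_tupleS_sigma_additive.

Let lebesgue_tupleS_sigma_finite : sigma_finite setT lebesgue_tupleS.
Proof.
have /sigma_finiteP[F [FT ndF Foo]] := sigma_finiteT (@lebesgue_measure R).
have /sigma_finiteP[G [GT ndG Goo]] := sigma_finiteT mu.
exists (fun i => @tuple_uncons _ (measurableTypeR R) n @^-1` (F i `*` G i)).
  rewrite -preimage_bigcup (_ : \bigcup_i _ = setT) ?preimage_setT//.
  rewrite -setXTT FT GT predeqE => -[a t]; split.
    by move=> [i _ []/= ? ?]; split; exists i.
  move=> [/= [i _ Fia] [j _ Gjt]]; exists (maxn i j) => //; split.
  - by move: a Fia; exact/subsetPset/ndF/leq_maxl.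
  - by move: t Gjt; exact/subsetPset/ndG/leq_maxr.
move=> i; have [mF Fi] := Foo i; have [mG Gi] := Goo i; split.
  rewrite -[X in measurable X]setTI.
  by apply: measurable_tuple_uncons => //; exact: measurableX.
rewrite /lebesgue_tupleS /pushforward -comp_preimage.
rewrite (_ : _ \o _ = id); last by apply/funext => p /=; rewrite tuple_consK.
by rewrite preimage_id product_measure1E// lte_mul_pinfty// ge0_fin_numE.
Qed.

HB.instance Definition _ := @Measure_isSigmaFinite.Build _ _ _
  lebesgue_tupleS lebesgue_tupleS_sigma_finite.

End lebesgue_tupleS.

Fixpoint lebesgue_tuple (R : realType) (n : nat) :
    {sigma_finite_measure set (n.-tuple (measurableTypeR R)) -> \bar R} :=
  match n with
  | 0 => \d_ ([tuple] : 0.-tuple (measurableTypeR R))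
  | m.+1 => lebesgue_tupleS (lebesgue_tuple R m)
  end.

Lemma lebesgue_tuple_box (R : realType) (n : nat)
    (A : 'I_n -> set (measurableTypeR R)) :
  (forall i, measurable (A i)) ->
  lebesgue_tuple R n [set t | forall i, A i (tnth t i)] =
  (\prod_(i < n) @lebesgue_measure R (A i))%E.
Proof.
elim: n A => [|n IHn] A mA.
  by rewrite big_ord0 /= diracE mem_set//= => -[].
rewrite big_ord_recl /= /lebesgue_tupleS /pushforward.
rewrite -IHn; last by move=> i; exact: mA.
have mB : measurable [set t : n.-tuple (measurableTypeR R) |
    forall i, A (lift ord0 i) (tnth t i)].
  rewrite (_ : [set _ | _] =
      \bigcap_i ((@tnth n _)^~ i @^-1` A (lift ord0 i))); last first.
    by apply/seteqP; split => t /= tA i => [_|]; exact: tA.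
  apply: fin_bigcap_measurable => // i _.
  by rewrite -[X in measurable X]setTI; exact: measurable_tnth.
rewrite -product_measure1E//; congr (_ _).
apply/seteqP; split => -[a t] /= => [H|[Aa At] i].
  split=> [|i]; first by have := H ord0; rewrite tnth0.
  by have := H (lift ord0 i); rewrite tnthS.
by case: (unliftP ord0 i) => [j ->|->]; rewrite ?tnthS ?tnth0//; exact: At.
Qed.

(* Points of R^n are row vectors, as n.-tuple R has no vector space structure. *)
Definition row_of_tuple (R : realType) (n : nat)
  (t : n.-tuple (measurableTypeR R)) : 'rV[R]_n := \row_(i < n) tnth t i.

(* The norm `|x| on 'rV[R]_n is the sup norm. *)
Definition enorm (R : realType) (n : nat) (x : 'rV[R]_n) : R :=
  Num.sqrt (\sum_(i < n) x ord0 i ^+ 2).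

Definition Gamma (R : realType) (a : R) : R :=
  \int[@lebesgue_measure R]_(t in `]0, +oo[) (t `^ (a - 1) * expR (- t)).

Definition gamma_ns (R : realType) (n : nat) (s : R) : R :=
  s * 2 `^ (2 * s) * Gamma ((n%:R + 2 * s) / 2)
    / (pi `^ (n%:R / 2) * Gamma (1 - s)).

(* The value is an extended real: the integral of a measurable integrand that is
   not integrable is infinite, so a finite value entails absolute convergence.
   At z = 0 the integrand is 0 / 0 = 0. *)
Definition fracLaplacian (R : realType) (n : nat) (s : R) (v : 'rV[R]_n -> R)
    (x : 'rV[R]_n) : \bar R :=
  ((gamma_ns n s / 2)%:E * \int[lebesgue_tuple R n]_t
     (let z := row_of_tuple t in
      (2 * v x - v (x + z) - v (x - z)) / enorm z `^ (n%:R + 2 * s))%:E)%E.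

Definition alpha_ns (R : realType) (n : nat) (s : R) : R :=
  Gamma (n%:R / 2 - s) / (2 `^ (2 * s) * pi `^ (n%:R / 2) * Gamma s).

Definition E_sy (R : realType) (n : nat) (s y : R) (x : 'rV[R]_n) : R :=
  alpha_ns n s * (y ^+ 2 + enorm x ^+ 2) `^ (- ((n%:R - 2 * s) / 2)).

(* Main.v *)
(* With h = n/2, a = h - s, b = h + s and A = y^2 + |x|^2, write each term
   (y^2 + |x +- z|^2)^(-a) as a Gamma integral over t, and |z|^(-2b) as the Gamma
   integral of rho^(b-1) exp(-t rho |z|^2) with the parameter rescaled by t.  The
   z-integrals become Gaussian and the t-integral is again a Gamma integral, which
   leaves a multiple of the integral over rho > 0 of
   rho^(b-1) (rho^(-h) - (c + rho)^(-h)) for c = y^2/A; that one equals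
   Gamma(b) Gamma(1-s) c^s / (s Gamma(h)).
   The second difference has no sign, so Tonelli is applied separately to the two
   nonnegative parts of 2 v(x) - v(x+z) - v(x-z) = P - N, where
   P = 2 (A^(-a) - (A + |z|^2)^(-a)).  Their integrals correspond to c = 1 and to
   the difference of the cases 1 and c. *)
Require Import Defs.
From HB Require Import structures.
From mathcomp Require Import all_boot all_order all_algebra.
From mathcomp Require Import all_classical all_reals all_analysis.
From mathcomp Require Import measurable_realfun ring lra.

Import Order.TTheory GRing.Theory Num.Theory.
Import numFieldNormedType.Exports.

Set Implicit Arguments.
Unset Strict Implicit.
Unset Printing Implicit Defensive.

Local Open Scope classical_set_scope.
Local Open Scope ring_scope.

(** * Integrability together with a prescribed value of the integral *)

Section has_integral.
Context d (T : measurableType d) (R : realType) (mu : {measure set T -> \bar R}).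
Implicit Types (f g : T -> R) (v w k : R).

(** Bundling integrability with a real value lets sums, differences and multiples be formed without
    separate convergence conditions at each step. *)
Definition has_integral f v : Prop :=
  mu.-integrable setT (EFin \o f) /\ (\int[mu]_x (f x)%:E = v%:E)%E.

Lemma has_integral_measurable f v : has_integral f v -> measurable_fun setT f.
Proof. by case=> /integrableP[/measurable_EFinP]. Qed.

Lemma ge0_has_integral f v : measurable_fun setT f -> (forall x, 0 <= f x) ->
  (\int[mu]_x (f x)%:E = v%:E)%E -> has_integral f v.
Proof.
move=> mf f0 fv; split => //; apply/integrableP; split.
  exact/measurable_EFinP.
under eq_integral do rewrite /= ger0_norm//.
by rewrite fv ltry.
Qed.

Lemma has_integral_ge0 f v : (forall x, 0 <= f x) -> has_integral f v -> 0 <= v.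
Proof.
move=> f0 [_ fv]; rewrite -lee_fin -fv.
by apply: integral_ge0 => x _; rewrite lee_fin.
Qed.

Lemma eq_has_integral f g v w : f =1 g -> v = w ->
  has_integral f v -> has_integral g w.
Proof. by move=> /funext -> ->. Qed.

Lemma has_integral0 : has_integral (fun=> 0) 0.
Proof.
by split; [exact: integrable0|rewrite integral0].
Qed.

Lemma has_integralZl k f v : has_integral f v ->
  has_integral (fun x => k * f x) (k * v).
Proof.
move=> [intf fv]; split.
  exact: (integrableZl measurableT k intf).
under eq_integral do rewrite EFinM.
by rewrite integralZl// fv.
Qed.

Lemma has_integralD f g v w : has_integral f v -> has_integral g w ->
  has_integral (fun x => f x + g x) (v + w).
Proof.
move=> [intf fv] [intg gw]; split.
  exact: (integrableD measurableT intf intg).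
under eq_integral do rewrite EFinD.
by rewrite (integralD measurableT intf intg) fv gw.
Qed.

Lemma has_integralB f g v w : has_integral f v -> has_integral g w ->
  has_integral (fun x => f x - g x) (v - w).
Proof.
move=> [intf fv] [intg gw]; split.
  exact: (integrableB measurableT intf intg).
under eq_integral do rewrite EFinB.
by rewrite (integralB measurableT intf intg) fv gw.
Qed.

(** Domination supplies a finite integral whose value is not known beforehand; this is how the Gamma
    integral is shown to converge. *)
Lemma le_has_integral f g w : measurable_fun setT f ->
  (forall x, 0 <= f x <= g x) -> has_integral g w ->
  exists v, has_integral f v.
Proof.
move=> mf fg [intg gw].
exists (fine (\int[mu]_x (f x)%:E)%E); apply: ge0_has_integral => //.
  by move=> x; case/andP: (fg x).
rewrite fineK//; apply: integrable_fin_num => //.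
apply: le_integrable intg => //; first exact/measurable_EFinP.
move=> x _; rewrite /= lee_fin; case/andP: (fg x) => f0 fgx.
by rewrite !ger0_norm// (le_trans f0).
Qed.

Lemma has_integral_le f g v w : (forall x, f x <= g x) ->
  has_integral f v -> has_integral g w -> v <= w.
Proof.
move=> fg [intf fv] [intg gw]; rewrite -lee_fin -fv -gw.
by apply: le_integral => // x _; rewrite lee_fin.
Qed.

End has_integral.

(* The library registers [m1 \x m2] as a sigma-finite measure only when [m1] and
   [m2] are subprobabilities, hence this alias. *)
Section sigma_finite_product.
Context d1 d2 (T1 : measurableType d1) (T2 : measurableType d2) (R : realType).
Variables (m1 : {sigma_finite_measure set T1 -> \bar R}).
Variables (m2 : {sigma_finite_measure set T2 -> \bar R}).

Definition sigma_finite_prod : set (T1 * T2) -> \bar R := (m1 \x m2)%E.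

HB.instance Definition _ := Measure.on sigma_finite_prod.

Let sigma_finite_prod_sigma_finite : sigma_finite setT sigma_finite_prod.
Proof.
have /sigma_finiteP[F [FT ndF Ffin]] := sigma_finiteT m1.
have /sigma_finiteP[G [GT ndG Gfin]] := sigma_finiteT m2.
exists (fun k => F k `*` G k) => [|k].
  apply/esym/seteqP; split => // -[x y] _.
  have [i _ Fix] : (\bigcup_i F i) x by rewrite -FT.
  have [j _ Gjy] : (\bigcup_i G i) y by rewrite -GT.
  exists (maxn i j) => //; split => /=.
    by move: x Fix; exact/subsetPset/ndF/leq_maxl.
  by move: y Gjy; exact/subsetPset/ndG/leq_maxr.
have [mF Foo] := Ffin k; have [mG Goo] := Gfin k; split; first exact: measurableX.
by rewrite /sigma_finite_prod product_measure1E// lte_mul_pinfty// ge0_fin_numE.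
Qed.

HB.instance Definition _ := @Measure_isSigmaFinite.Build _ _ _
  sigma_finite_prod sigma_finite_prod_sigma_finite.

End sigma_finite_product.

(** * Tonelli's theorem for nonnegative real functions *)

Section tonelli.
Context d1 d2 (T1 : measurableType d1) (T2 : measurableType d2) (R : realType).
Variables (m1 : {sigma_finite_measure set T1 -> \bar R}).
Variables (m2 : {sigma_finite_measure set T2 -> \bar R}).
Variable f : T1 * T2 -> R.
Hypotheses (mf : measurable_fun setT f) (f0 : forall z, 0 <= f z).

Let mEf : measurable_fun setT (EFin \o f).
Proof. exact/measurable_EFinP. Qed.

Let Ef0 z : (0 <= (EFin \o f) z)%E.
Proof. by rewrite /= lee_fin. Qed.

Lemma has_integral_prod1 (g : T1 -> R) (v : R) :
  (forall x, has_integral m2 (fun y => f (x, y)) (g x)) ->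
  has_integral m1 g v -> has_integral (m1 \x m2)%E f v.
Proof.
move=> fg [_ gv]; apply: ge0_has_integral => //.
rewrite (fubini_tonelli1 (EFin \o f))// -gv.
by apply: eq_integral => x _; case: (fg x).
Qed.

Lemma has_integral_prod2 (g : T2 -> R) (v : R) :
  (forall y, has_integral m1 (fun x => f (x, y)) (g y)) ->
  has_integral m2 g v -> has_integral (m1 \x m2)%E f v.
Proof.
move=> fg [_ gv]; apply: ge0_has_integral => //.
rewrite (fubini_tonelli2 (EFin \o f))// -gv.
by apply: eq_integral => x _; case: (fg x).
Qed.

Lemma measurable_has_integral (g : T1 -> R) :
  (forall x, has_integral m2 (fun y => f (x, y)) (g x)) -> measurable_fun setT g.
Proof.
move=> fg; apply/measurable_EFinP.
rewrite (_ : EFin \o g = fubini_F m2 (EFin \o f)).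
  exact: measurable_fun_fubini_tonelli_F.
by apply/funext => x; rewrite /fubini_F/=; case: (fg x).
Qed.

(** Integrability of [h] is a conclusion: its measurability comes from that of the partial integrals
    of [f], its value from the product integral. *)
Lemma has_integral_section2 (h : T2 -> R) (v : R) :
  has_integral (m1 \x m2)%E f v ->
  (forall y, has_integral m1 (fun x => f (x, y)) (h y)) ->
  has_integral m2 h v.
Proof.
move=> [_ fv] fh.
have hE : EFin \o h = fubini_G m1 (EFin \o f).
  by apply/funext => y; rewrite /fubini_G/=; case: (fh y).
apply: ge0_has_integral.
- apply/measurable_EFinP; rewrite hE.
  exact: measurable_fun_fubini_tonelli_G.
- move=> y; apply: has_integral_ge0 (fh y) => x; exact: f0.
- rewrite -fv (fubini_tonelli2 (EFin \o f))//.
  by apply: eq_integral => y _; rewrite -hE.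
Qed.

(** Evaluates the integral of a function [h] recognised as an inner integral, by integrating in the
    other order. *)
Lemma has_integral_swap (g : T1 -> R) (h : T2 -> R) (v : R) :
  (forall x, has_integral m2 (fun y => f (x, y)) (g x)) ->
  (forall y, has_integral m1 (fun x => f (x, y)) (h y)) ->
  has_integral m1 g v -> has_integral m2 h v.
Proof.
by move=> fg fh gv; apply: has_integral_section2 fh; exact: has_integral_prod1 gv.
Qed.

End tonelli.

(** * Integrals over ]0, c] with a possible singularity at 0 *)

Section half_line.
Variable R : realType.
Implicit Types (a c l r s t u v : R) (f F : R -> R).
Notation leb := (@lebesgue_measure R).

Lemma has_integral_itv (i : interval R) f v :
  measurable_fun setT f -> (forall x, x \in i -> 0 <= f x) ->
  (\int[leb]_(x in [set` i]) (f x)%:E = v%:E)%E ->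
  has_integral leb (fun x => f x * (x \in i)%:R) v.
Proof.
move=> mf f0 fv.
have E x : f x * (x \in i)%:R = (f \_ [set` i]) x.
  rewrite patchE; case: (boolP (x \in i)) => xi; first by rewrite mem_set// mulr1.
  by rewrite memNset ?mulr0//; exact/negP.
apply: ge0_has_integral.
- under eq_fun do rewrite E.
  by apply/measurable_restrict => //; exact: measurable_funTS.
- by move=> x; case: (boolP (x \in i)) => [/f0|]; rewrite ?mulr1// mulr0.
- rewrite -fv [RHS]integral_mkcond; apply: eq_integral => x _.
  by rewrite E restrict_EFin.
Qed.

(** Since [f] may blow up at 0, the fundamental theorem of calculus is applied on closed intervals
    inside ]0, c]; these exhaust ]0, c], and monotone convergence passes to the limit. *)
Lemma has_integral_FTC_at_right0 f F c l : 0 < c -> measurable_fun setT f ->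
  (forall x, 0 < x -> 0 <= f x) -> (forall x : R, 0 < x -> {for x, continuous f}) ->
  (forall x : R, 0 < x -> is_derive x 1 F (f x)) -> F x @[x --> 0^'+] --> l ->
  has_integral leb (fun x => f x * (x \in `]0, c])%:R) (F c - l).
Proof.
move=> c0 mf f0 cf dF Fl.
apply: has_integral_itv => //.
  by move=> x; rewrite in_itv/= => /andP[/f0].
(* The denominators start at 2, so [e i] is strictly below [c] already for [i = 0]. *)
pose e (i : nat) : R := c / i.+2%:R.
have e0 i : 0 < e i by rewrite divr_gt0.
have ec i : e i < c by rewrite ltr_pdivrMr// ltr_pMr// ltr1n.
have e_cvg : e i @[i --> \oo] --> (0 : R).
  rewrite -[X in _ --> X](mulr0 c); apply: cvgMl_tmp.
  have := @cvg_harmonic R; rewrite -(cvg_shiftS (@harmonic R : nat -> R^o)); exact.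
have -> : [set` `]0, c]] = \bigcup_i [set` `[e i, c]].
  apply/seteqP; split => x /=; rewrite in_itv/=.
    move=> /andP[x0 xc].
    have /cvgrPdist_lt/(_ x x0)[k _ /(_ k (leqnn k))/=] := e_cvg.
    rewrite sub0r normrN gtr0_norm// => ekx.
    by exists k => //=; rewrite in_itv/= xc ltW.
  by move=> [k _ /=]; rewrite in_itv/= => /andP[ekx ->]; rewrite (lt_le_trans _ ekx).
have Fe : (fun i => (\int[leb]_(x in [set` `[e i, c]]) (f x)%:E)%E) =
    (fun i => (F c - F (e i))%:E).
  apply/funext => i; rewrite (@continuous_FTC2 _ f F) ?EFinB//.
  - apply: continuous_in_subspaceT => x; rewrite inE/= in_itv/= => /andP[eix _].
    by apply: cf; rewrite (lt_le_trans _ eix).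
  - split.
    + move=> x; rewrite in_itv/= => /andP[eix _].
      by have [] := dF x (lt_trans (e0 i) eix).
    + apply: cvg_at_right_filter.
      by apply/differentiable_continuous/derivable1_diffP; have [] := dF _ (e0 i).
    + apply: cvg_at_left_filter.
      by apply/differentiable_continuous/derivable1_diffP; have [] := dF _ c0.
  - move=> x; rewrite in_itv/= => /andP[eix _].
    by rewrite derive1E; have [] := dF x (lt_trans (e0 i) eix).
have Fcvg : ((F c - F (e i))%:E @[i --> \oo] --> (F c - l)%:E)%E.
  apply: cvg_EFin; first by near=> i.
  by apply: cvgB; [exact: cvg_cst|move/cvg_at_rightP : Fl; apply; split].
apply: (cvg_unique _ _ Fcvg) => //.
rewrite -Fe; apply: ge0_nondecreasing_set_cvg_integral.
- apply/nondecreasing_seqP => i; apply/subsetPset => x /=; rewrite !in_itv/=.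
  move=> /andP[eix ->]; rewrite andbT (le_trans _ eix)//.
  by rewrite ler_pM2l// lef_pV2 ?posrE// ler_nat.
- by move=> i; exact: measurable_itv.
- by move=> i; apply/measurable_funTS/measurable_EFinP.
- move=> i x /=; rewrite in_itv/= => /andP[eix _].
  by rewrite lee_fin f0// (lt_le_trans _ eix).
Unshelve. all: by end_near. Qed.

End half_line.

(** * The Mellin weight and the Gamma integral *)

Section mellin.
Variable R : realType.
Implicit Types (a b c e r s t u v x : R).
Notation leb := (@lebesgue_measure R).

(** The weight of the Mellin transform, cut off outside the positive half-line so that integrals
    over ]0, +oo[ become integrals over the whole line, the form in which Tonelli is applied. *)
Definition mellin e t : R := t `^ (e - 1) * (0 < t)%R%:R.

Lemma mellin_ge0 e t : 0 <= mellin e t.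
Proof. by rewrite mulr_ge0// powR_ge0. Qed.

Lemma mellin_gt0E e t : 0 < t -> mellin e t = t `^ (e - 1).
Proof. by rewrite /mellin => ->; rewrite mulr1. Qed.

Lemma mellin_le0E e t : t <= 0 -> mellin e t = 0.
Proof. by rewrite /mellin ltNge => ->; rewrite mulr0. Qed.

Lemma mellinM e t a : mellin e t * t `^ a = mellin (e + a) t.
Proof.
rewrite /mellin; have [t0|_] := ltP 0 t; last by rewrite !mulr0 mul0r.
rewrite !mulr1 -powRD; first by congr (_ `^ _); ring.
by rewrite (gt_eqF t0) implybT.
Qed.

Lemma measurable_mellin e : measurable_fun setT (mellin e).
Proof.
apply: measurable_funM; first exact: measurable_powR.
apply: (measurableT_comp (f := fun b : bool => b%:R : R)) => //.
exact: measurable_fun_ltr.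
Qed.

Lemma has_integral_powR s c : 0 < s -> 0 < c ->
  has_integral leb (fun u => mellin s u * (u <= c)%R%:R) (c `^ s / s).
Proof.
move=> s0 c0.
suff: has_integral leb (fun u => u `^ (s - 1) * (u \in `]0, c])%:R)
    (c `^ s / s - 0).
  rewrite subr0; apply: eq_has_integral => // u.
  rewrite /mellin in_itv/=.
  by have [_|_] := ltP 0 u; rewrite /= ?mulr1// !mulr0 mul0r.
apply: (has_integral_FTC_at_right0 (F := fun u => u `^ s / s)) => //.
- by move=> x _; exact: powR_ge0.
- move=> x x0; apply/differentiable_continuous/derivable1_diffP.
  by have [] := is_derive1_powR (s - 1) x0.
- move=> x x0; have := is_derive1_powR s x0 => dx.
  rewrite (_ : (fun u => _) = s^-1 \*: (@powR R ^~ s)); last first.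
    by apply/funext => u /=; rewrite mulrC.
  apply: is_derive_eq; rewrite /= /GRing.scale/= mulrA mulVf ?mul1r//.
  by rewrite gt_eqF.
- rewrite -[X in _ --> X](mul0r s^-1); apply: cvgMr_tmp.
  exact: powR_cvg0.
Qed.

(** Raise u <= 1 + u <= exp u at u = t/(2a) to the power [a]. Only half of the decay of [expR (- t)]
    is spent on absorbing the power. *)
Lemma powR_le_expR a t : 0 < a -> 0 < t ->
  t `^ a <= (2 * a) `^ a * expR (t / 2).
Proof.
move=> a0 t0; have a20 : 0 < 2 * a by rewrite mulr_gt0.
have -> : expR (t / 2) = expR (t / (2 * a)) `^ a.
  rewrite -expRM; congr expR; field; by rewrite gt_eqF.
rewrite -powRM ?expR_ge0 ?(ltW a20)//.
rewrite ge0_ler_powR ?nnegrE ?(ltW a0) ?(ltW t0)//.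
  by rewrite mulr_ge0 ?expR_ge0// ltW.
rewrite mulrC -ler_pdivrMr//.
by rewrite (le_trans _ (expR_ge1Dx _))// lerDr.
Qed.

Lemma measurable_expRNM c : measurable_fun setT (fun t => expR (- (c * t))).
Proof. by apply: measurableT_comp => //; exact: measurableT_comp. Qed.

Lemma has_integral_exponential_pdf r : 0 < r ->
  has_integral leb (exponential_pdf r) 1.
Proof.
move=> r0; apply: ge0_has_integral; first exact: measurable_exponential_pdf.
- by move=> x; rewrite exponential_pdf_ge0// ltW.
- exact: integral_exponential_pdf.
Qed.

Lemma GammaE a v :
  has_integral leb (fun t => mellin a t * expR (- t)) v -> Gamma a = v.
Proof.
move=> [_ av]; rewrite /Gamma /Rintegral integral_mkcond.
rewrite -[RHS]/(fine v%:E) -av; congr fine; apply: eq_integral => t _.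
rewrite patchE /mellin; case: ifPn; rewrite ?inE/= ?notin_setE/= in_itv/= andbT.
  by move=> ->; rewrite mulr1.
by move/negP/negbTE => ->; rewrite mulr0 mul0r.
Qed.

Lemma has_integral_Gamma a : 0 < a ->
  has_integral leb (fun t => mellin a t * expR (- t)) (Gamma a).
Proof.
move=> a0.
suff [v av] : exists v, has_integral leb (fun t => mellin a t * expR (- t)) v.
  by rewrite (GammaE av).
(* The first summand dominates on ]0, 1], the second beyond 1. For t > 0, [exponential_pdf 2^-1] is
   exp(-t/2)/2, hence twice the constant of [powR_le_expR]. *)
have dom : has_integral leb (fun t => mellin a t * (t <= 1)%R%:R +
    2 * (2 * a) `^ a * exponential_pdf 2^-1 t)
    (1 `^ a / a + 2 * (2 * a) `^ a * 1).
  apply: has_integralD; first exact: has_integral_powR.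
  by apply: has_integralZl; apply: has_integral_exponential_pdf.
apply: le_has_integral dom.
- apply: measurable_funM; first exact: measurable_mellin.
  by under eq_fun do rewrite -[X in - X]mul1r; exact: measurable_expRNM.
- move=> t; rewrite mulr_ge0 ?mellin_ge0 ?expR_ge0//=.
  have [t0|t0] := leP t 0.
    by rewrite mellin_le0E// !mul0r add0r !mulr_ge0 ?powR_ge0 ?exponential_pdf_ge0.
  have [t1|t1] := leP t 1.
    rewrite mulr1 ler_wpDr//.
      by rewrite !mulr_ge0 ?powR_ge0 ?exponential_pdf_ge0.
    by rewrite ler_piMr ?mellin_ge0// expR_le1 oppr_le0 ltW.
  rewrite mulr0 add0r mellin_gt0E// exponential_pdfE ?(ltW t0)//.
  rewrite (_ : 2 * (2 * a) `^ a * _ = (2 * a) `^ a * expR (t / 2) * expR (- t)); last first.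
    rewrite -[RHS]mulrA -expRD (_ : t / 2 - t = - 2^-1 * t); last by field.
    by field.
  rewrite ler_wpM2r ?expR_ge0// (le_trans _ (powR_le_expR a0 t0))//.
  by rewrite ler_powR ?(ltW t1)// lerBlDr lerDl.
Qed.

(** On ]0, 1] the integrand is at least t^(a-1)/e, whose integral there is 1/(e a). *)
Lemma Gamma_gt0 a : 0 < a -> 0 < Gamma a.
Proof.
move=> a0.
have low := has_integralZl (expR (- 1)) (has_integral_powR a0 ltr01).
apply: (lt_le_trans _ (has_integral_le _ low (has_integral_Gamma a0))).
  by rewrite mulr_gt0 ?expR_gt0// divr_gt0// powR_gt0.
move=> t; have [t1|_] := leP t 1.
  by rewrite mulr1 mulrC ler_wpM2l ?mellin_ge0// ler_expR lerN2.
by rewrite !mulr0 mulr_ge0 ?mellin_ge0 ?expR_ge0.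
Qed.

End mellin.

(** * Dilations of the line and the rescaled Gamma integral *)

Section scaling.
Variable R : realType.
Implicit Types (a b c e r s t u v x : R).
Notation leb := (@lebesgue_measure R).

Lemma preimage_mulr_ocitv c x y : 0 < c ->
  (fun t => c * t) @^-1` `]x, y]%classic = `](x / c), (y / c)]%classic.
Proof.
move=> c0; apply/seteqP; split => t /=; rewrite !in_itv/= ltr_pdivrMr// ler_pdivlMr//;
  by rewrite ![t * c]mulrC.
Qed.

(** The rescaled image measure agrees with Lebesgue measure on half-open intervals, which determine
    it. *)
Lemma lebesgue_measure_scale c (A : set (measurableTypeR R)) : 0 < c ->
  measurable A -> (c%:E * leb ((fun t => c * t)%R @^-1` A) = leb A)%E.
Proof.
move=> c0 mA; have mc : measurable_fun [set: measurableTypeR R]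
    (fun t => c * t : measurableTypeR R) by exact: measurable_funM.
pose m := measure_function_pushforward__canonical__measure_function_Measure leb mc.
apply/esym/(lebesgue_measure_unique (mu := mscale (NngNum (ltW c0)) m)) => //= _ [[a b]] _ <-.
rewrite /mscale/= /pushforward/= preimage_mulr_ocitv// !lebesgue_measure_itv/=.
rewrite !lte_fin ltr_pM2r ?invr_gt0//; case: ifPn => _; last by rewrite mule0.
rewrite -!EFinB -EFinM; congr EFin; field; by rewrite gt_eqF.
Qed.

Lemma has_integral_scale c f v : 0 < c -> (forall t, 0 <= f t) ->
  has_integral leb f v -> has_integral leb (fun t => f (c * t)) (v / c).
Proof.
move=> c0 f0 fv; have mf := has_integral_measurable fv.
have mc : measurable_fun [set: measurableTypeR R]
    (fun t => c * t : measurableTypeR R) by exact: measurable_funM.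
apply: ge0_has_integral => //; first exact: (measurableT_comp mf mc).
have [_] := fv.
pose m := measure_function_pushforward__canonical__measure_function_Measure leb mc.
rewrite (@eq_measure_integral _ _ _ _ (mscale (NngNum (ltW c0)) m)); last first.
  by move=> A mA _; apply/esym/lebesgue_measure_scale.
rewrite ge0_integral_mscale//=; last 2 first.
- exact/measurable_EFinP.
- by move=> t _; rewrite lee_fin.
rewrite ge0_integral_pushforward//=; last 2 first.
- exact/measurable_EFinP.
- by move=> t _; rewrite lee_fin.
rewrite preimage_setT => E.
have cN0 : c != 0 by rewrite gt_eqF.
have := congr1 (fun z => (c^-1)%:E * z)%E E.
by rewrite muleA -EFinM mulVf// mul1e => ->; rewrite -EFinM mulrC.
Qed.

(** Substitution of [B * t] in the Gamma integral. Read backwards, it writes a negative power of [B]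
    as a superposition of exponentials in [B]. *)
Lemma has_integral_mellin_expR a B : 0 < a -> 0 < B ->
  has_integral leb (fun t => mellin a t * expR (- (B * t))) (Gamma a * B `^ (- a)).
Proof.
move=> a0 B0.
have := has_integralZl (B `^ (1 - a)) (has_integral_scale B0 _ (has_integral_Gamma a0)).
have H t : 0 <= mellin a t * expR (- t) by rewrite mulr_ge0 ?expR_ge0 ?mellin_ge0.
move=> /(_ H); apply: eq_has_integral => [t|].
  rewrite mulrA; congr (_ * _); have [t0|t0] := leP t 0.
    by rewrite !mellin_le0E ?mulr0// pmulr_rle0.
  rewrite !mellin_gt0E ?mulr_gt0// powRM ?(ltW t0) ?(ltW B0)// mulrA.
  rewrite -powRD ?(gt_eqF B0) ?implybT// (_ : 1 - a + (a - 1) = 0) ?powRr0 ?mul1r//.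
  ring.
rewrite mulrCA; congr (_ * _); rewrite -[B^-1]powR_inv1 ?(ltW B0)//.
rewrite -powRD ?(gt_eqF B0) ?implybT//; congr (_ `^ _); ring.
Qed.
End scaling.

(** * Mellin transforms of 1 - exp(-c tau) and of a difference of powers *)

Section mellin_transforms.
Variable R : realType.
Implicit Types (a b c e r s t u v x h rho tau : R).
Notation leb := (@lebesgue_measure R).

(** [mellin 1] is the indicator of ]0, +oo[, so this is the elementary integral of exp(-u tau) over
    ]0, c]. *)
Lemma has_integral_expR_itv c tau : 0 < c -> 0 < tau ->
  has_integral leb (fun u => mellin 1 u * (u <= c)%R%:R * expR (- (u * tau)))
    ((1 - expR (- (c * tau))) / tau).
Proof.
move=> c0 t0.
have dF (x : R) : is_derive x 1 (fun u : R => - tau^-1 * expR (- tau * u))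
    (expR (- tau * x)).
  apply: is_derive_eq; rewrite /GRing.scale/= mulr1.
  by field; rewrite gt_eqF.
have df (x : R) : derivable (fun u : R => expR (- tau * u)) x 1.
  exact: ex_derive.
suff: has_integral leb (fun u => expR (- tau * u) * (u \in `]0, c])%:R)
    (- tau^-1 * expR (- tau * c) - (- tau^-1 * expR (- tau * 0))).
  apply: eq_has_integral => [u|]; last by rewrite mulr0 expR0 !mulNr [tau * c]mulrC; ring.
  rewrite /mellin in_itv/= subrr powRr0 mul1r mulrC mulNr [tau * u]mulrC.
  by case: (0 < u)%R; case: (u <= c)%R; rewrite /= ?(mulr1, mul1r, mulr0, mul0r).
apply: (has_integral_FTC_at_right0 (F := fun u : R => - tau^-1 * expR (- tau * u))) => //.
- by under eq_fun do rewrite mulNr; exact: measurable_expRNM.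
- move=> x x0; apply/differentiable_continuous/derivable1_diffP; exact: df.
- have cF : {for (0 : R), continuous (fun u : R => - tau^-1 * expR (- tau * u))}.
    by apply/differentiable_continuous/derivable1_diffP; have [] := dF 0.
  exact: cvg_at_right_filter cF.
Qed.

(** Write (1 - exp(-c tau))/tau as the integral of exp(-u tau) over ]0, c] and integrate in tau
    first. This leaves Gamma(1-s) u^(s-1): [s < 1] makes the Gamma integral converge, and [0 < s]
    makes the power integrable at 0. *)
Lemma has_integral_mellin_onem_expR s c : 0 < s -> s < 1 -> 0 < c ->
  has_integral leb (fun tau => mellin (- s) tau * (1 - expR (- (c * tau))))
    (Gamma (1 - s) * (c `^ s / s)).
Proof.
move=> s0 s1 c0.
apply: (@has_integral_swap _ _ _ _ R leb leb
  (fun z => mellin 1 z.1 * (z.1 <= c)%R%:R * mellin (1 - s) z.2 * expR (- (z.1 * z.2)))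
  _ _ (fun u => Gamma (1 - s) * (mellin s u * (u <= c)%R%:R))).
- apply: measurable_funM.
    apply: measurable_funM; last first.
      by apply: measurableT_comp; first exact: measurable_mellin.
    apply: measurable_funM.
      by apply: measurableT_comp; first exact: measurable_mellin.
    apply: (measurableT_comp (f := fun b : bool => b%:R : R)) => //.
    exact: measurable_fun_ler.
  apply: measurableT_comp => //; apply: measurableT_comp => //.
  exact: measurable_funM.
- by move=> z; rewrite !mulr_ge0 ?mellin_ge0 ?powR_ge0 ?expR_ge0.
- move=> u /=; have [u0|u0] := leP u 0.
    apply: eq_has_integral (has_integral0 _) => [t|]; rewrite mellin_le0E ?mul0r//.
    by rewrite mulr0.
  have s10 : 0 < 1 - s by rewrite subr_gt0.
  have := has_integralZl (mellin 1 u * (u <= c)%R%:R) (has_integral_mellin_expR s10 u0).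
  apply: eq_has_integral => [t|]; first by rewrite mulrA.
  rewrite opprB -[mellin s u](_ : mellin 1 u * u `^ (s - 1) = _); last first.
    by rewrite mellinM; congr mellin; ring.
  ring.
- move=> t /=; have [t0|t0] := leP t 0.
    by apply: eq_has_integral (has_integral0 _) => [u|];
      rewrite (mellin_le0E _ t0) ?mul0r ?mulr0 ?mul0r.
  have := has_integralZl (mellin (1 - s) t) (has_integral_expR_itv c0 t0).
  apply: eq_has_integral => [u|]; first by ring.
  rewrite mulrC -mulrA mulrC; congr (_ * _).
  rewrite -[t^-1]powR_inv1 ?(ltW t0)// mulrC mellinM; congr mellin; ring.
- by apply: has_integralZl; exact: has_integral_powR.
Qed.

(** [Gamma h] times the difference of powers is the integral of t^(h-1) exp(-t rho) (1 - exp(-c t))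
    over t > 0. Integrating in rho first gives Gamma(h+s) t^(-h-s), which reduces to the previous
    transform. *)
Lemma has_integral_mellin_powR_sub h s c : 0 < h -> 0 < s -> s < 1 -> 0 < c ->
  has_integral leb
    (fun rho => mellin (h + s) rho * (Gamma h * (rho `^ (- h) - (c + rho) `^ (- h))))
    (Gamma (h + s) * (Gamma (1 - s) * (c `^ s / s))).
Proof.
move=> h0 s0 s1 c0.
apply: (@has_integral_swap _ _ _ _ R leb leb
  (fun z => mellin h z.1 * mellin (h + s) z.2 * expR (- (z.1 * z.2)) *
                 (1 - expR (- (c * z.1))))
  _ _ (fun u => Gamma (h + s) * (mellin (- s) u * (1 - expR (- (c * u)))))).
- apply: measurable_funM; last first.
    apply: measurable_funB => //.
    apply: measurableT_comp => //; apply: measurableT_comp => //.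
    exact: measurable_funM.
  apply: measurable_funM.
    by apply: measurable_funM; apply: measurableT_comp; first [exact: measurable_mellin|done].
  apply: measurableT_comp => //; apply: measurableT_comp => //.
  exact: measurable_funM.
- move=> z; have [t0|t0] := leP z.1 0; first by rewrite mellin_le0E// !mul0r.
  rewrite !mulr_ge0 ?mellin_ge0 ?powR_ge0 ?expR_ge0//.
  by rewrite subr_ge0 expR_le1 oppr_le0 mulr_ge0// ltW.
- move=> t /=; have [t0|t0] := leP t 0.
    by apply: eq_has_integral (has_integral0 _) => [u|]; rewrite mellin_le0E ?mul0r ?mulr0.
  have hs0 : 0 < h + s by rewrite addr_gt0.
  have := has_integralZl (mellin h t * (1 - expR (- (c * t)))) (has_integral_mellin_expR hs0 t0).
  apply: eq_has_integral => [u|]; first by ring.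
  rewrite -[mellin (- s) t](_ : mellin h t * t `^ (- (h + s)) = _); last first.
    by rewrite mellinM; congr mellin; ring.
  ring.
- move=> u /=; have [u0|u0] := leP u 0.
    by apply: eq_has_integral (has_integral0 _) => [t|];
      rewrite (mellin_le0E _ u0) ?mul0r// ?mulr0 ?mul0r.
  have cu0 : 0 < c + u by rewrite addr_gt0.
  have := has_integralZl (mellin (h + s) u)
    (has_integralB (has_integral_mellin_expR h0 u0) (has_integral_mellin_expR h0 cu0)).
  apply: eq_has_integral => [t|]; last by ring.
  by rewrite [(c + u) * t]mulrDl opprD expRD [u * t]mulrC; ring.
- by apply: has_integralZl; exact: has_integral_mellin_onem_expR.
Qed.
End mellin_transforms.

(** * Product functions on R^n and one-dimensional Gaussians *)

Section gaussian.
Variable R : realType.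
Implicit Types (a r v x : R).
Notation leb := (@lebesgue_measure R).
Notation lebt := (@lebesgue_tuple R).

Lemma has_integral_tupleS n (f : n.+1.-tuple (measurableTypeR R) -> R) v :
  measurable_fun setT f -> (forall t, 0 <= f t) ->
  has_integral (leb \x lebt n)%E (f \o @tuple_cons _ (measurableTypeR R) n) v ->
  has_integral (lebt n.+1) f v.
Proof.
move=> mf f0 [_ fv]; apply: ge0_has_integral => //.
have mc := @measurable_tuple_cons _ (measurableTypeR R) n.
pose m := measure_function_pushforward__canonical__measure_function_Measure
  (leb \x lebt n)%E mc.
rewrite (@eq_measure_integral _ _ _ _ m)//.
rewrite ge0_integral_pushforward//=; first exact/measurable_EFinP.
by move=> t _; rewrite lee_fin.
Qed.

(** Tonelli peels off one coordinate at a time. At length 0 the measure is the Dirac mass at the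
    empty tuple and the empty product is 1. *)
Lemma has_integral_tuple_prod n (f : 'I_n -> R -> R) (v : 'I_n -> R) :
  (forall i x, 0 <= f i x) -> (forall i, has_integral leb (f i) (v i)) ->
  has_integral (lebt n) (fun t => \prod_(i < n) f i (tnth t i)) (\prod_(i < n) v i).
Proof.
have mprod m (g : 'I_m -> R -> R) w : (forall i, has_integral leb (g i) (w i)) ->
    measurable_fun [set: m.-tuple (measurableTypeR R)]
      (fun t => \prod_(i < m) g i (tnth t i)).
  move=> gw; apply: measurable_prod => i _.
  apply: measurableT_comp; first exact: has_integral_measurable (gw i).
  exact: measurable_tnth.
elim: n f v => [|n IHn] f v f0 fv.
  apply: ge0_has_integral.
  - exact: mprod fv.
  - by move=> t; apply: prodr_ge0.
  - by rewrite big_ord0 integral_dirac//= ?diracT ?mul1e ?big_ord0//;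
      apply/measurable_EFinP; exact: mprod fv.
apply: has_integral_tupleS.
- exact: mprod fv.
- by move=> t; apply: prodr_ge0.
have E (p : measurableTypeR R * n.-tuple (measurableTypeR R)) :
    \prod_(i < n.+1) f i (tnth (tuple_cons p) i) =
    f ord0 p.1 * \prod_(i < n) f (lift ord0 i) (tnth p.2 i).
  rewrite big_ord_recl; congr (_ * _).
  by apply: eq_bigr => i _; congr (f _ _); exact: tnthS.
rewrite [X in has_integral _ X](funext E).
apply: (has_integral_prod1 (m1 := leb) (m2 := lebt n)).
- apply: measurable_funM; last first.
    have m2 := mprod _ (fun i => f (lift ord0 i)) _ (fun i => fv (lift ord0 i)).
    exact: (measurableT_comp m2 measurable_snd).
  exact: (measurableT_comp (has_integral_measurable (fv ord0)) measurable_fst).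
- by move=> p; rewrite mulr_ge0// prodr_ge0.
- move=> x /=; apply: has_integralZl.
  by apply: (IHn (fun i => f (lift ord0 i)) (fun i => v (lift ord0 i))) => i; [exact: f0|exact: fv].
- rewrite big_ord_recl mulrC.
  under eq_fun do rewrite mulrC.
  exact: has_integralZl.
Qed.

Lemma has_integral_gauss r a : 0 < r ->
  has_integral leb (fun z => expR (- (r * (z - a) ^+ 2))) ((pi / r) `^ 2^-1).
Proof.
move=> r0.
(* The normal density of variance 1/(2r) has exponent -r (z - a)^2 and peak 1/sqrt(pi/r). *)
pose sg := Num.sqrt ((2 * r)^-1).
have sg0 : 0 < sg by rewrite sqrtr_gt0 invr_gt0 mulr_gt0.
have sg2 : sg ^+ 2 = (2 * r)^-1 by rewrite sqr_sqrtr// invr_ge0 mulr_ge0 ?ltW.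
have pdf : has_integral leb (normal_pdf a sg) 1.
  apply: ge0_has_integral; first exact: measurable_normal_pdf.
  - by move=> x; exact: normal_pdf_ge0.
  - by rewrite integral_normal_pdf// gt_eqF.
have := has_integralZl ((pi / r) `^ 2^-1) pdf.
rewrite mulr1; apply: eq_has_integral => // z.
rewrite normal_pdfE ?gt_eqF// /normal_peak /normal_fun sg2.
rewrite powR12_sqrt ?divr_ge0 ?pi_ge0 ?(ltW r0)//.
rewrite (_ : (2 * r)^-1 * pi *+ 2 = pi / r); last first.
  by rewrite -mulr_natl; field; rewrite gt_eqF.
rewrite mulrA mulfV ?mul1r; last by rewrite gt_eqF// sqrtr_gt0 divr_gt0// pi_gt0.
congr expR; rewrite -mulr_natl; field; by rewrite gt_eqF.
Qed.

(* Completing the square: [r z^2 + t (x+z)^2 = (r+t) (z + tx/(r+t))^2 + rt/(r+t) x^2]. *)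
Lemma has_integral_gauss2 r (t : R) x : 0 < r -> 0 <= t ->
  has_integral leb (fun z => expR (- (r * z ^+ 2)) * expR (- (t * (x + z) ^+ 2)))
    ((pi / (r + t)) `^ 2^-1 * expR (- (r * t / (r + t) * x ^+ 2))).
Proof.
move=> r0 t0; have rt0 : 0 < r + t by rewrite ltr_pwDl.
have := has_integralZl (expR (- (r * t / (r + t) * x ^+ 2)))
  (has_integral_gauss (- (t * x / (r + t))) rt0).
apply: eq_has_integral => [z|]; last by rewrite mulrC.
rewrite -!expRD; congr expR; field; by rewrite gt_eqF.
Qed.

End gaussian.

(** * The Euclidean norm and Gaussian integrals on R^n *)

Section enorm.
Variables (R : realType) (n : nat).
Implicit Types x z : 'rV[R]_n.

Lemma enorm_ge0 x : 0 <= enorm x. Proof. exact: sqrtr_ge0. Qed.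

Lemma sqr_enorm x : enorm x ^+ 2 = \sum_(i < n) x ord0 i ^+ 2.
Proof. by rewrite sqr_sqrtr// sumr_ge0// => i _; rewrite sqr_ge0. Qed.

Lemma enorm0 : enorm (0 : 'rV[R]_n) = 0.
Proof. by rewrite /enorm big1 ?sqrtr0// => i _; rewrite mxE expr0n. Qed.

Lemma enormN x : enorm (- x) = enorm x.
Proof. by congr Num.sqrt; apply: eq_bigr => i _; rewrite mxE sqrrN. Qed.

Lemma enorm_eq0 x : enorm x = 0 -> x = 0.
Proof.
move=> x0; apply/rowP => i; rewrite mxE.
have /eqP : \sum_(i < n) x ord0 i ^+ 2 = 0 by rewrite -sqr_enorm x0 expr0n.
rewrite psumr_eq0; last by move=> j _; rewrite sqr_ge0.
by move=> /allP/(_ i (mem_index_enum i)); rewrite sqrf_eq0 => /eqP.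
Qed.

Lemma sqr_enormD x z :
  enorm (x + z) ^+ 2 = enorm x ^+ 2 + enorm z ^+ 2 +
    2 * \sum_(i < n) x ord0 i * z ord0 i.
Proof.
rewrite !sqr_enorm mulr_sumr -!big_split/=; apply: eq_bigr => i _.
by rewrite mxE; ring.
Qed.

Lemma sqr_enormB x z :
  enorm (x - z) ^+ 2 = enorm x ^+ 2 + enorm z ^+ 2 -
    2 * \sum_(i < n) x ord0 i * z ord0 i.
Proof.
rewrite sqr_enormD enormN -mulrN -sumrN; congr (_ + 2 * _).
by apply: eq_bigr => i _; rewrite mxE mulrN.
Qed.

Lemma measurable_sqr_enormD x :
  measurable_fun setT (fun z : n.-tuple (measurableTypeR R) =>
    enorm (x + row_of_tuple z) ^+ 2).
Proof.
under eq_fun do rewrite sqr_enorm.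
apply: measurable_sum => i.
under eq_fun do rewrite !mxE.
apply: measurable_funX; apply: measurable_funD => //; exact: measurable_tnth.
Qed.

Lemma measurable_sqr_enorm :
  measurable_fun setT (fun z : n.-tuple (measurableTypeR R) =>
    enorm (row_of_tuple z) ^+ 2).
Proof.
by under eq_fun do rewrite -[row_of_tuple _]add0r; exact: measurable_sqr_enormD.
Qed.

(** Squared norms are sums over coordinates, so the integrand is a product of the integrands of
    [has_integral_gauss2], and the n square roots combine to the power n/2. *)
Lemma has_integral_gauss_tuple (r t : R) x : 0 < r -> 0 <= t ->
  has_integral (lebesgue_tuple R n)
    (fun p => expR (- (r * enorm (row_of_tuple p) ^+ 2)) *
              expR (- (t * enorm (x + row_of_tuple p) ^+ 2)))
    ((pi / (r + t)) `^ (n%:R / 2) * expR (- (r * t / (r + t) * enorm x ^+ 2))).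
Proof.
move=> r0 t0.
have H := has_integral_tuple_prod _ (fun i => has_integral_gauss2 (x ord0 i) r0 t0).
have {}H := H (fun i u => mulr_ge0 (expR_ge0 _) (expR_ge0 _)).
have prodE (c : R) (f : 'I_n -> R) :
    \prod_(i < n) expR (- (c * f i)) = expR (- (c * \sum_(i < n) f i)).
  by rewrite mulr_sumr -sumrN expR_sum.
move: H; apply: eq_has_integral => [p|].
  rewrite big_split/= !prodE !sqr_enorm.
  by congr (expR (- (_ * _)) * expR (- (_ * _))); apply: eq_bigr => i _; rewrite !mxE.
rewrite big_split/= prodE sqr_enorm prodr_const card_ord; congr (_ * _).
by rewrite -powR_mulrn ?powR_ge0// -powRrM [2^-1 * _]mulrC.
Qed.

Lemma has_integral_gauss_tuple0 (r : R) : 0 < r ->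
  has_integral (lebesgue_tuple R n)
    (fun p => expR (- (r * enorm (row_of_tuple p) ^+ 2))) ((pi / r) `^ (n%:R / 2)).
Proof.
move=> r0; apply: eq_has_integral (has_integral_gauss_tuple 0 r0 (lexx 0)) => [p|].
  by rewrite mul0r oppr0 expR0 mulr1.
by rewrite addr0 mulr0 !mul0r oppr0 expR0 mulr1.
Qed.

End enorm.

(** * Integration against the kernel |z|^(-n-2s) by exchanging three integrals *)

Section riesz_kernel.
Variables (R : realType) (n : nat) (s : R).
Hypotheses (s0 : 0 < s) (ns : 0 < n%:R / 2 - s).
Notation leb := (@lebesgue_measure R).
Notation lebn := (lebesgue_tuple R n).
Notation tupleR := (n.-tuple (measurableTypeR R)).
Notation h := (n%:R / 2).

Variable phi : measurableTypeR R * tupleR -> R.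
Hypotheses (mphi : measurable_fun setT phi) (phi_ge0 : forall p, 0 <= phi p).
Hypothesis phi0 : forall t z, row_of_tuple z = 0 -> phi (t, z) = 0.

(** One nonnegative function [F] of t, rho and z is integrated in two orders. Taking z, then t, then
    rho gives [v]; with z fixed, taking rho and then t produces the kernel times [psi z]. *)
Lemma has_integral_riesz_kernel (k : R -> R -> R) (K : R -> R) (psi : tupleR -> R)
    (v : R) :
  (forall t rho : R, 0 < t -> 0 < rho -> has_integral lebn
    (fun z => expR (- (t * rho * enorm (row_of_tuple z) ^+ 2)) * phi (t, z))
    (k t rho)) ->
  (forall rho : R, 0 < rho ->
    has_integral leb (fun t => mellin n%:R t * k t rho) (K rho)) ->
  has_integral leb (fun rho => mellin (h + s) rho * K rho) v ->
  (forall z, has_integral leb (fun t => mellin (h - s) t * phi (t, z)) (psi z)) ->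
  has_integral lebn (fun z =>
    Gamma (h + s) * (psi z / enorm (row_of_tuple z) `^ (n%:R + 2 * s))) v.
Proof.
move=> kP KP vP psiP.
have hs0 : 0 < h + s by rewrite addr_gt0// (lt_trans s0)// -subr_gt0.
(* The weight t^(n-1) is t^(h-s-1) from [psi] times the t^(h+s) created by rescaling the Gamma
   variable to t rho, since n = 2h. *)
pose F (q : (measurableTypeR R * measurableTypeR R) * tupleR) : R :=
  mellin n%:R q.1.1 * mellin (h + s) q.1.2 *
  (expR (- (q.1.1 * q.1.2 * enorm (row_of_tuple q.2) ^+ 2)) * phi (q.1.1, q.2)).
have m11 : measurable_fun setT
    (fun q : (measurableTypeR R * measurableTypeR R) * tupleR => q.1.1).
  exact: (measurableT_comp measurable_fst measurable_fst).
have m12 : measurable_fun setT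
    (fun q : (measurableTypeR R * measurableTypeR R) * tupleR => q.1.2).
  exact: (measurableT_comp measurable_snd measurable_fst).
have mF : measurable_fun setT F.
  apply: measurable_funM.
    apply: measurable_funM.
      exact: (measurableT_comp (measurable_mellin _) m11).
    exact: (measurableT_comp (measurable_mellin _) m12).
  apply: measurable_funM.
    apply: measurableT_comp => //; apply: measurableT_comp => //.
    apply: measurable_funM; first exact: measurable_funM.
    exact: (measurableT_comp (@measurable_sqr_enorm R n) measurable_snd).
  apply: (measurableT_comp mphi).
  exact: (measurable_fun_pair m11 measurable_snd).
have F0 q : 0 <= F q by rewrite !mulr_ge0 ?mellin_ge0 ?expR_ge0 ?powR_ge0.
pose g (p : measurableTypeR R * measurableTypeR R) : R :=
  mellin n%:R p.1 * mellin (h + s) p.2 * k p.1 p.2.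
have gP p : has_integral lebn (fun z => F (p, z)) (g p).
  case: p => t rho; rewrite /F /g/=.
  have [t0|t0] := leP t 0.
    by apply: eq_has_integral (has_integral0 _) => [z|]; rewrite (mellin_le0E _ t0) !mul0r.
  have [rho0|rho0] := leP rho 0.
    by apply: eq_has_integral (has_integral0 _) => [z|];
      rewrite (mellin_le0E _ rho0) mulr0 !mul0r.
  by apply: has_integralZl; exact: kP.
apply: (@has_integral_section2 _ _ _ _ R (sigma_finite_prod leb leb) lebn F mF F0 _ v).
- have mg : measurable_fun setT g := measurable_has_integral mF F0 gP.
  have g0 p : 0 <= g p by apply: has_integral_ge0 (gP p) => z; exact: F0.
  apply: (has_integral_prod1 mF F0 gP).
  apply: (has_integral_prod2 mg g0 _ vP) => rho.
  rewrite /g/=; have [rho0|rho0] := leP rho 0.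
    by apply: eq_has_integral (has_integral0 _) => [z|];
      rewrite (mellin_le0E _ rho0) ?mulr0 !mul0r.
  apply: eq_has_integral (has_integralZl (mellin (h + s) rho) (KP _ rho0)) => // t.
  ring.
- move=> z; pose E := enorm (row_of_tuple z).
  have nsN0 : n%:R + 2 * s != 0 by rewrite gt_eqF// ltr_wpDl// mulr_gt0.
  (* At z = 0 the exponential does not decay and the kernel has no Gamma representation. There
     [phi0] makes [F] vanish, and the quotient is 0 because the inverse of 0 is 0. *)
  have [/enorm_eq0 z0|EN0] := eqVneq E 0.
    apply: eq_has_integral (has_integral0 _) => [p|].
      by rewrite /F/= phi0// !mulr0.
    by rewrite z0 enorm0 powR0// invr0 !mulr0.
  have E0 : 0 < E by rewrite lt_neqAle eq_sym EN0 enorm_ge0.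
  have mFz : measurable_fun setT (fun p => F (p, z)).
    exact: measurable_fun_pair1 mF.
  apply: (has_integral_prod1 mFz (fun p => F0 (p, z)) (g := fun t =>
    Gamma (h + s) / E `^ (n%:R + 2 * s) * (mellin (h - s) t * phi (t, z)))).
  + move=> t; rewrite /F/=; have [t0|t0] := leP t 0.
      by apply: eq_has_integral (has_integral0 _) => [r|];
        rewrite (mellin_le0E _ t0) !mul0r ?mulr0.
    have tE0 : 0 < t * E ^+ 2 by rewrite mulr_gt0// exprn_gt0.
    have := has_integralZl (mellin n%:R t * phi (t, z)) (has_integral_mellin_expR hs0 tE0).
    apply: eq_has_integral => [r|].
      by rewrite [t * r]mulrC -[r * t * _]mulrA [r * _]mulrC; ring.
    rewrite powRM ?(ltW t0) ?sqr_ge0// -[E ^+ 2]powR_mulrn ?(ltW E0)// -powRrM.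
    rewrite -powRN (_ : 2%:R * - (h + s) = - (n%:R + 2 * s)); last by field.
    rewrite -[mellin (h - s) t](_ : mellin n%:R t * t `^ (- (h + s)) = _); last first.
      by rewrite mellinM; congr mellin; field.
    ring.
  + have := has_integralZl (Gamma (h + s) / E `^ (n%:R + 2 * s)) (psiP z).
    by apply: eq_has_integral => //; rewrite -/E; ring.
Qed.

End riesz_kernel.

(** * The integral of the second difference of (y^2 + |x|^2)^(-(h-s)) *)

Section second_difference.
Variables (R : realType) (n : nat) (s y : R) (x : 'rV[R]_n).
Hypotheses (s0 : 0 < s) (s1 : s < 1) (ns : 0 < n%:R / 2 - s) (y0 : 0 < y).
Notation leb := (@lebesgue_measure R).
Notation lebn := (lebesgue_tuple R n).
Notation tupleR := (n.-tuple (measurableTypeR R)).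
Notation h := (n%:R / 2).
Notation rowt := (@row_of_tuple R n).

Let A : R := y ^+ 2 + enorm x ^+ 2.
(** [M] is the mean of [Bp] and [Bm], whose cross terms in x and z have opposite signs. *)
Let M (z : tupleR) : R := A + enorm (rowt z) ^+ 2.
Let Bp (z : tupleR) : R := y ^+ 2 + enorm (x + rowt z) ^+ 2.
Let Bm (z : tupleR) : R := y ^+ 2 + enorm (x - rowt z) ^+ 2.

Let y20 : 0 < y ^+ 2. Proof. by rewrite exprn_gt0. Qed.
Let A0 : 0 < A. Proof. by rewrite ltr_pwDl// sqr_ge0. Qed.
Let M0 z : 0 < M z. Proof. by rewrite ltr_pwDl// sqr_ge0. Qed.
Let Bp0 z : 0 < Bp z. Proof. by rewrite ltr_pwDl// sqr_ge0. Qed.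
Let Bm0 z : 0 < Bm z. Proof. by rewrite ltr_pwDl// sqr_ge0. Qed.
Let h0 : 0 < h :> R. Proof. by rewrite (lt_trans s0)// -subr_gt0. Qed.

(** For t > 0, [phiP - phiN] is 2 exp(-A t) - exp(-Bp t) - exp(-Bm t), with 2 exp(-M t) inserted to
    make both parts nonnegative. The indicator in [phiP] is there because its other factor changes
    sign with t. *)
Let phiP (p : measurableTypeR R * tupleR) : R :=
  2 * (expR (- (A * p.1)) - expR (- (M p.2 * p.1))) * (0 < p.1)%R%:R.
Let phiN (p : measurableTypeR R * tupleR) : R :=
  expR (- (Bp p.2 * p.1)) + expR (- (Bm p.2 * p.1)) - 2 * expR (- (M p.2 * p.1)).

Let mM : measurable_fun setT M.
Proof. by apply: measurable_funD => //; exact: measurable_sqr_enorm. Qed.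
Let mBp : measurable_fun setT Bp.
Proof. by apply: measurable_funD => //; exact: measurable_sqr_enormD. Qed.
Let mBm : measurable_fun setT Bm.
Proof.
apply: measurable_funD => //.
under eq_fun do rewrite -enormN opprB addrC.
exact: measurable_sqr_enormD.
Qed.

Let mexp (B : tupleR -> R) : measurable_fun setT B ->
  measurable_fun setT (fun p : measurableTypeR R * tupleR => expR (- (B p.2 * p.1))).
Proof.
move=> mB; apply: measurableT_comp => //; apply: measurableT_comp => //.
apply: measurable_funM; last exact: measurable_fst.
exact: (measurableT_comp mB measurable_snd).
Qed.

Let mphiP : measurable_fun setT phiP.
Proof.
apply: measurable_funM.
  apply: measurable_funM => //; apply: measurable_funB; last exact: mexp.
  exact: (mexp (measurable_cst A)).
apply: (measurableT_comp (f := fun b : bool => b%:R : R)) => //.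
by apply: measurable_fun_ltr => //; exact: measurable_fst.
Qed.

Let mphiN : measurable_fun setT phiN.
Proof.
apply: measurable_funB; first by apply: measurable_funD; exact: mexp.
by apply: measurable_funM => //; exact: mexp.
Qed.

Let phiP_ge0 p : 0 <= phiP p.
Proof.
rewrite /phiP; have [t0|_] := ltP 0 p.1; last by rewrite mulr0.
rewrite mulr1 mulr_ge0// subr_ge0 ler_expR lerN2 ler_pM2r//.
by rewrite lerDl sqr_ge0.
Qed.

(** Convexity of the exponential at the mean [M], made explicit: with [d] the inner product of x and
    z, the value is exp(-M t) (exp(d t) - exp(-d t))^2. *)
Let phiN_ge0 p : 0 <= phiN p.
Proof.
rewrite /phiN; set d := \sum_(i < n) x ord0 i * rowt p.2 ord0 i.
have -> : Bp p.2 = M p.2 + 2 * d by rewrite /Bp /M /A sqr_enormD -/d; ring.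
have -> : Bm p.2 = M p.2 - 2 * d by rewrite /Bm /M /A sqr_enormB -/d; ring.
have e2 (c : R) : expR (2 * c) = expR c ^+ 2 by rewrite mulr2n mulrDl mul1r expRD.
have -> : - ((M p.2 + 2 * d) * p.1) = - (M p.2 * p.1) + 2 * - (d * p.1) by ring.
have -> : - ((M p.2 - 2 * d) * p.1) = - (M p.2 * p.1) + 2 * (d * p.1) by ring.
rewrite !expRD !e2; set a := expR (- (M _ * _)).
have eN : expR (d * p.1) * expR (- (d * p.1)) = 1 by rewrite -expRD subrr expR0.
rewrite (_ : _ - _ = a * (expR (d * p.1) - expR (- (d * p.1))) ^+ 2).
  by rewrite mulr_ge0 ?expR_ge0 ?sqr_ge0.
set u := expR (d * _); set w := expR (- (d * _)).
have -> : (u - w) ^+ 2 = u ^+ 2 + w ^+ 2 - 2 * (u * w) by ring.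
by rewrite eN; ring.
Qed.

Let phiP0 t z : rowt z = 0 -> phiP (t, z) = 0.
Proof. by move=> z0; rewrite /phiP/= /M z0 enorm0 expr0n addr0 subrr mulr0 mul0r. Qed.

Let phiN0 t z : rowt z = 0 -> phiN (t, z) = 0.
Proof.
move=> z0; rewrite /phiN/= /M /Bp /Bm z0 subr0 addr0 enorm0 expr0n addr0.
by rewrite -/A; ring.
Qed.

Let c := y ^+ 2 / A.
Let c0 : 0 < c. Proof. by rewrite divr_gt0. Qed.

Let kP (t rho : R) : R :=
  2 * expR (- (A * t)) * ((pi / (t * rho)) `^ h - (pi / (t * (1 + rho))) `^ h).
Let kN (t rho : R) : R :=
  2 * (pi / (t * (1 + rho))) `^ h *
  (expR (- ((y ^+ 2 + rho / (1 + rho) * enorm x ^+ 2) * t)) - expR (- (A * t))).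

Let has_integral_kP (t rho : R) : 0 < t -> 0 < rho -> has_integral lebn
  (fun z => expR (- (t * rho * enorm (rowt z) ^+ 2)) * phiP (t, z)) (kP t rho).
Proof.
move=> t0 rho0; have r0 : 0 < t * rho by rewrite mulr_gt0.
have r1 : 0 < t * (1 + rho) by rewrite mulr_gt0// addr_gt0.
have := has_integralZl (2 * expR (- (A * t)))
  (has_integralB (has_integral_gauss_tuple0 n r0) (has_integral_gauss_tuple0 n r1)).
apply: eq_has_integral => // z.
rewrite /phiP/= t0 mulr1 /M.
rewrite (_ : - ((A + _) * t) = - (A * t) + - (t * enorm (rowt z) ^+ 2)); last by ring.
rewrite (_ : - (t * (1 + rho) * _) =
  - (t * rho * enorm (rowt z) ^+ 2) + - (t * enorm (rowt z) ^+ 2)); last by ring.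
by rewrite !expRD; ring.
Qed.

(** The Gaussians centred at -x and x have equal integrals, hence the factor 2 in [kN]. Completing
    the square leaves the rate t rho/(1 + rho) in front of |x|^2. *)
Let has_integral_kN (t rho : R) : 0 < t -> 0 < rho -> has_integral lebn
  (fun z => expR (- (t * rho * enorm (rowt z) ^+ 2)) * phiN (t, z)) (kN t rho).
Proof.
move=> t0 rho0; have r0 : 0 < t * rho by rewrite mulr_gt0.
have rho1 : 0 < 1 + rho by rewrite addr_gt0.
have r1 : 0 < t * (1 + rho) by rewrite mulr_gt0.
have Gp := has_integral_gauss_tuple x r0 (ltW t0).
have Gm := has_integral_gauss_tuple (- x) r0 (ltW t0).
have := has_integralB
  (has_integralZl (expR (- (y ^+ 2 * t))) (has_integralD Gp Gm))
  (has_integralZl (2 * expR (- (A * t))) (has_integral_gauss_tuple0 n r1)).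
apply: eq_has_integral => [z|].
  rewrite /phiN/= -[enorm (- x + _)]enormN opprD opprK /Bp /Bm /M.
  rewrite (_ : - ((A + _) * t) = - (A * t) + - (t * enorm (rowt z) ^+ 2)); last by ring.
  rewrite (_ : - (t * (1 + rho) * _) =
    - (t * rho * enorm (rowt z) ^+ 2) + - (t * enorm (rowt z) ^+ 2)); last by ring.
  rewrite ![(y ^+ 2 + _) * t]mulrDl !opprD !expRD ![_ * t]mulrC; ring.
rewrite enormN /kN (_ : t * rho + t = t * (1 + rho)); last by ring.
rewrite (_ : - ((y ^+ 2 + _) * t) = - (y ^+ 2 * t) +
  - (t * rho * t / (t * (1 + rho)) * enorm x ^+ 2)); last first.
  by field; rewrite !gt_eqF.
by rewrite expRD; ring.
Qed.

Let powR_piV (t a : R) : 0 < t -> 0 < a ->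
  (pi / (t * a)) `^ h = pi `^ h * (t `^ (- h) * a `^ (- h)).
Proof.
move=> t0 a0; rewrite powRM ?pi_ge0 ?invr_ge0 ?ltW ?mulr_gt0//.
congr (_ * _); rewrite -powRM ?(ltW t0) ?(ltW a0)//.
by rewrite -[(t * a)^-1]powR_inv1 ?ltW ?mulr_gt0// -powRrM mulN1r.
Qed.

(** The Gaussian z-integral contributes t^(-n/2), which halves the exponent of the weight. *)
Let mellin_half (t : R) : mellin n%:R t * t `^ (- h) = mellin h t.
Proof. by rewrite mellinM; congr mellin; field. Qed.

Let KP (rho : R) : R := 2 * pi `^ h * A `^ (- h) *
  (Gamma h * (rho `^ (- h) - (1 + rho) `^ (- h))).
(** The powers rho^(-h) cancel; keeping them displays [KN] as the difference of the cases 1 and [c]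
    of [has_integral_mellin_powR_sub]. *)
Let KN (rho : R) : R := 2 * pi `^ h * A `^ (- h) *
  (Gamma h * (rho `^ (- h) - (1 + rho) `^ (- h)) -
   Gamma h * (rho `^ (- h) - (c + rho) `^ (- h))).

Let has_integral_KP (rho : R) : 0 < rho ->
  has_integral leb (fun t => mellin n%:R t * kP t rho) (KP rho).
Proof.
move=> rho0; have rho1 : 0 < 1 + rho by rewrite addr_gt0.
have := has_integralZl (2 * pi `^ h * (rho `^ (- h) - (1 + rho) `^ (- h)))
  (has_integral_mellin_expR h0 A0).
apply: eq_has_integral => [t|]; last by rewrite /KP; ring.
have [t0|t0] := leP t 0; first by rewrite !mellin_le0E// !mul0r mulr0.
by rewrite /kP !powR_piV// -mellin_half; ring.
Qed.

Let has_integral_KN (rho : R) : 0 < rho ->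
  has_integral leb (fun t => mellin n%:R t * kN t rho) (KN rho).
Proof.
move=> rho0; have rho1 : 0 < 1 + rho by rewrite addr_gt0.
have B0 : 0 < y ^+ 2 + rho / (1 + rho) * enorm x ^+ 2.
  by rewrite ltr_pwDl// mulr_ge0 ?sqr_ge0// divr_ge0// ltW.
have := has_integralZl (2 * pi `^ h * (1 + rho) `^ (- h))
  (has_integralB (has_integral_mellin_expR h0 B0) (has_integral_mellin_expR h0 A0)).
apply: eq_has_integral => [t|].
  have [t0|t0] := leP t 0; first by rewrite !mellin_le0E// !mul0r subrr mulr0.
  by rewrite /kN !powR_piV// -mellin_half; ring.
(* The origin of [c]: (1 + rho) y^2 + rho |x|^2 = y^2 + rho A = A (c + rho). *)
have E : (1 + rho) `^ (- h) * (y ^+ 2 + rho / (1 + rho) * enorm x ^+ 2) `^ (- h) =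
    A `^ (- h) * (c + rho) `^ (- h).
  rewrite -!powRM ?ltW//; last by rewrite addr_gt0.
  have Ac : A * c = y ^+ 2 by rewrite mulrC divfK// gt_eqF.
  by congr (_ `^ _); rewrite [A * (c + _)]mulrDr Ac /A; field; rewrite gt_eqF.
transitivity (2 * pi `^ h * Gamma h *
  ((1 + rho) `^ (- h) * (y ^+ 2 + rho / (1 + rho) * enorm x ^+ 2) `^ (- h) -
   (1 + rho) `^ (- h) * A `^ (- h))); first by ring.
by rewrite E /KN; ring.
Qed.

Lemma has_integral_second_difference :
  has_integral lebn (fun z =>
    (2 * (y ^+ 2 + enorm x ^+ 2) `^ (- (h - s))
     - (y ^+ 2 + enorm (x + rowt z) ^+ 2) `^ (- (h - s))
     - (y ^+ 2 + enorm (x - rowt z) ^+ 2) `^ (- (h - s)))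
    / enorm (rowt z) `^ (n%:R + 2 * s))
  (2 * pi `^ h * Gamma (1 - s) / (s * Gamma (h - s)) *
   (y `^ (2 * s) * (y ^+ 2 + enorm x ^+ 2) `^ (- (h + s)))).
Proof.
pose V (b : R) := 2 * pi `^ h * A `^ (- h) *
  (Gamma (h + s) * (Gamma (1 - s) * (b `^ s / s))).
have L (b : R) : 0 < b -> has_integral leb (fun rho => mellin (h + s) rho *
    (2 * pi `^ h * A `^ (- h) * (Gamma h * (rho `^ (- h) - (b + rho) `^ (- h))))) (V b).
  move=> b0; have := has_integralZl (2 * pi `^ h * A `^ (- h))
    (has_integral_mellin_powR_sub h0 s0 s1 b0).
  by apply: eq_has_integral => // rho; ring.
have LN : has_integral leb (fun rho => mellin (h + s) rho * KN rho) (V 1 - V c).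
  apply: eq_has_integral (has_integralB (L 1 ltr01) (L c c0)) => // rho.
  by rewrite /KN; ring.
have psiP z : has_integral leb (fun t => mellin (h - s) t * phiP (t, z))
    (2 * (Gamma (h - s) * A `^ (- (h - s)) - Gamma (h - s) * M z `^ (- (h - s)))).
  have := has_integralZl 2 (has_integralB (has_integral_mellin_expR ns A0)
    (has_integral_mellin_expR ns (M0 z))).
  apply: eq_has_integral => // t; rewrite /phiP/=.
  have [t0|t0] := leP t 0; first by rewrite mellin_le0E// !mul0r subrr mulr0.
  by rewrite mulr1; ring.
have psiN z : has_integral leb (fun t => mellin (h - s) t * phiN (t, z))
    (Gamma (h - s) * Bp z `^ (- (h - s)) + Gamma (h - s) * Bm z `^ (- (h - s))
     - 2 * (Gamma (h - s) * M z `^ (- (h - s)))).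
  have := has_integralB (has_integralD (has_integral_mellin_expR ns (Bp0 z))
      (has_integral_mellin_expR ns (Bm0 z)))
    (has_integralZl 2 (has_integral_mellin_expR ns (M0 z))).
  by apply: eq_has_integral => // t; rewrite /phiN/=; ring.
have IP := has_integral_riesz_kernel s0 ns mphiP phiP_ge0 phiP0
  has_integral_kP has_integral_KP (L 1 ltr01) psiP.
have IN := has_integral_riesz_kernel s0 ns mphiN phiN_ge0 phiN0
  has_integral_kN has_integral_KN LN psiN.
have Ga0 : 0 < Gamma (h - s) :> R by exact: Gamma_gt0.
have Gb0 : 0 < Gamma (h + s) :> R by apply: Gamma_gt0; exact: addr_gt0.
(* Subtraction cancels the [M] terms in the integrand and [V 1] in the value, leaving [V c]. The
   Gamma factors divided out come from the integral representations of the powers and of the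
   kernel. *)
have := has_integralZl (Gamma (h - s) * Gamma (h + s))^-1 (has_integralB IP IN).
apply: eq_has_integral => [z|].
  rewrite -/A -/(Bp z) -/(Bm z).
  move: (Gamma (h - s)) (Gamma (h + s)) Ga0 Gb0 => Ga Gb Ga0 Gb0.
  move: (A `^ _) (M z `^ _) (Bp z `^ _) (Bm z `^ _) (enorm _ `^ _)^-1 => ? ? ? ? ?.
  by field; rewrite (gt_eqF Ga0) gt_eqF.
(* Together with the factor A^(-h) in [V], this gives y^(2s) A^(-(h+s)). *)
rewrite -/A /V (_ : c `^ s = y `^ (2 * s) * A `^ (- s)).
  rewrite [- (h + s)]opprD powRD; last by rewrite (gt_eqF A0) implybT.
  move: (Gamma (h - s)) (Gamma (h + s)) Ga0 Gb0 => Ga Gb Ga0 Gb0.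
  move: (Gamma (1 - s)) (A `^ (- h)) (A `^ (- s)) (1 `^ s) (pi `^ h) => ? ? ? ? ?.
  move: (y `^ _) => ?.
  by field; rewrite (gt_eqF Ga0) (gt_eqF Gb0) gt_eqF.
rewrite /c powRM ?(ltW y20) ?invr_ge0 ?(ltW A0)// -[A^-1]powR_inv1 ?(ltW A0)//.
by rewrite -powR_mulrn ?(ltW y0)// -!powRrM mulN1r.
Qed.

End second_difference.

(** * Collecting the constants [gamma_ns] and [alpha_ns] *)

Theorem lemma8p6 (R : realType) (n : nat) (s : R)
    (s_gt0 : 0 < s) (s_lt1 : s < 1)
    (n_s : (2 <= n)%N \/ (n = 1%N /\ s < 1 / 2))
    (y : R) (y_gt0 : 0 < y) (x : 'rV[R]_n) :
  fracLaplacian s (E_sy s y) x =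
  (y `^ (2 * s) * (Gamma (n%:R / 2 + s) / (pi `^ (n%:R / 2) * Gamma s))
   * (y ^+ 2 + enorm x ^+ 2) `^ (- (n%:R / 2 + s)))%:E.
Proof.
(* Both alternatives on the dimension give s < n/2, so the integral of Gamma(n/2 - s) converges. *)
have ns : 0 < n%:R / 2 - s.
  case: n_s => [n2|[-> s2]]; last by rewrite subr_gt0.
  by rewrite subr_gt0 (lt_le_trans s_lt1)// ler_pdivlMr// mul1r ler_nat.
have [_] := has_integralZl (alpha_ns n s)
  (has_integral_second_difference x s_gt0 s_lt1 ns y_gt0).
rewrite /fracLaplacian => I.
rewrite [X in (_ * X)%E](_ : _ = (alpha_ns n s *
  (2 * pi `^ (n%:R / 2) * Gamma (1 - s) / (s * Gamma (n%:R / 2 - s)) *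
   (y `^ (2 * s) * (y ^+ 2 + enorm x ^+ 2) `^ (- (n%:R / 2 + s)))))%:E); last first.
  rewrite -I; apply: eq_integral => z _; congr EFin; rewrite /E_sy.
  rewrite (_ : (n%:R - 2 * s) / 2 = n%:R / 2 - s); last by field.
  by rewrite [RHS]mulrA !mulrBr [alpha_ns n s * (2 * _)]mulrCA.
rewrite -EFinM; congr EFin.
have Ga : 0 < Gamma (n%:R / 2 - s) :> R := Gamma_gt0 ns.
have Gs : 0 < Gamma s :> R := Gamma_gt0 s_gt0.
have G1s : 0 < Gamma (1 - s) :> R by apply: Gamma_gt0; rewrite subr_gt0.
have p0 : 0 < pi `^ (n%:R / 2) :> R by rewrite powR_gt0// pi_gt0.
have t0 : 0 < 2 `^ (2 * s) :> R by rewrite powR_gt0.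
rewrite /gamma_ns /alpha_ns (_ : (n%:R + 2 * s) / 2 = n%:R / 2 + s); last by field.
(* With these values abstracted as positive unknowns, half of [gamma_ns] times [alpha_ns] times the
   constant of the second difference is a rational expression, in which all but Gamma(n/2 + s), [p]
   and [Gs] cancels. *)
move: (Gamma (_ - s)) (Gamma s) (Gamma (1 - s)) (pi `^ _) (2 `^ _) Ga Gs G1s p0 t0.
move=> Ga Gs G1s p t Ga0 Gs0 G1s0 p0 t0.
by field; rewrite !gt_eqF.
Qed.
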